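(* $\mathbb{R}$ is an $\mathbb{M}$-algebra with structure map $c_{\mathbb{R}}:M\mathbb{R}\to\mathbb{R}$ given by $$c_{\mathbb{R}}(\mu)=\int\mathrm{id}_{\mathbb{R}}\,d\mu,$$ where the right-hand side is the Lebesgue integral of the identity map $\mathrm{id}_{\mathbb{R}}:\mathbb{R}\to\mathbb{R}$ with respect to $\mu$. In fact, $\mathbb{R}$ is isomorphic (as an $\mathbb{M}$-algebra) to the free $\mathbb{M}$-algebra $M1$ on the one-point measurable bornological set $1=\{*\}$.
   Context: A bornology on a set $X$ is a collection of subsets of $X$ (the bounded subsets) closed under taking subsets and finite unions (in particular containing $\emptyset$) and containing all singletons. A measurable bornological set is a set equipped with both a bornology and a sigma-algebra; $\mathbf{BornMeas}$ is the category of these with maps that are measurable and bornological (images of bounded sets are bounded). $\mathbb{R}$ carries its Borel sigma-algebra and usual bornology. A subset $A\subseteq X$ carries the sigma-algebra $\{A\cap E\mid E\subseteq X\text{ measurable}\}$ and the bornology of those subsets of $A$ bounded in $X$. For a measurable space $X$, $SX$ is the real vector space of all finite signed measures on $X$, with the sigma-algebra generated by the evaluation maps $\mathrm{Ev}_E:\mu\mapsto\mu(E)$ ($E$ measurable) and the total variation norm $\|\mu\|=|\mu|(X)$. For $f:X\to Y$ measurable, $Sf(\mu)$ is the direct image measure $F\mapsto\mu(f^{-1}(F))$. $\mu\in SX$ is supported by a subset $A\subseteq X$ if it is the direct image, along the inclusion $A\hookrightarrow X$, of some measure in $SA$. The monad $\mathbb{M}=(M,\delta,\kappa)$ on $\mathbf{BornMeas}$: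 $MX$ is the set of all $\mu\in SX$ supported by some bounded $B\subseteq X$, with sigma-algebra generated by the maps $\mathrm{Ev}_E:MX\to\mathbb{R}$ and bornology consisting of all subsets of the sets $M(B,X,\gamma)=\{\mu\in MX\mid\mu\text{ supported by }B,\ \|\mu\|\leqslant\gamma\}$ ($B\subseteq X$ bounded, $\gamma\geqslant0$); $Mf$ is the restriction of $Sf$; $\delta_X(x)=\delta_x$ is the Dirac measure; $(\kappa_X(\mathcal{M}))(E)=\int\mathrm{Ev}_E\,d\mathcal{M}$ for $\mathcal{M}\in MMX$. An $\mathbb{M}$-algebra is $X\in\mathbf{BornMeas}$ with a $\mathbf{BornMeas}$-morphism $c:MX\to X$ such that $c\circ\delta_X=1_X$ and $c\circ Mc=c\circ\kappa_X$; an $\mathbb{M}$-homomorphism $(X,c)\to(Y,d)$ is a $\mathbf{BornMeas}$-morphism $\phi$ with $\phi\circ c=d\circ M\phi$. The free $\mathbb{M}$-algebra on $X$ is $(MX,\kappa_X)$. *)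

(* Defs.v *)
From HB Require Import structures.
From mathcomp Require Import all_boot all_order all_algebra.
From mathcomp Require Import all_classical all_reals all_analysis.
From mathcomp Require Import measurable_realfun.

Set Implicit Arguments.
Unset Strict Implicit.
Unset Printing Implicit Defensive.

Import Order.TTheory GRing.Theory Num.Theory.
Import numFieldNormedType.Exports.

Local Open Scope classical_set_scope.
Local Open Scope ring_scope.

Record bornology (T : Type) := Bornology {
  bounded : set (set T) ;
  bounded_set0 : bounded set0 ;
  bounded_subset : forall A B, A `<=` B -> bounded B -> bounded A ;
  bounded_setU : forall A B, bounded A -> bounded B -> bounded (A `|` B) ;
  bounded_set1 : forall x, bounded [set x] }.

(* A [measurableType] is pointed, so only the nonempty objects of the category
   are represented; [M] sends every object to a nonempty one. *)
Record bornMeas := BornMeas {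
  bm_display : measure_display ;
  bm_space :> measurableType bm_display ;
  bm_born : bornology bm_space }.

Definition bm_bounded (X : bornMeas) : set (set X) := bounded (bm_born X).
Arguments bm_bounded : clear implicits.

Definition is_bornMeas_mor (X Y : bornMeas) (f : X -> Y) : Prop :=
  measurable_fun [set: X] f /\
  (forall B, bm_bounded X B -> bm_bounded Y (f @` B)).

Section smeasure.
Context d (T : measurableType d) (R : realType).

(* The values of a library charge on non-measurable sets are unconstrained;
   imposing 0 there makes Leibniz equality of two elements of [smeasure] the
   same as equality on measurable sets. *)
Record smeasure := SMeasure {
  sm_charge :> {charge set T -> \bar R} ;
  sm_out : forall E, ~ measurable E -> sm_charge E = 0%E }.

Lemma smeasure_ext (mu nu : smeasure) :
  (forall E, measurable E -> mu E = nu E) -> mu = nu.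
Proof.
move=> h; have {}h : (mu : set T -> \bar R) = nu.
  apply/funext => E; have [/h//|mE] := pselect (measurable E).
  by rewrite !sm_out.
have {h} : sm_charge mu = nu.
  case: (sm_charge mu) (sm_charge nu) h => {}mu [[a1] [a2] [a3]].
  move=> -[{}nu [[b1] [b2] [b3]]] /= h; subst nu.
  by rewrite (Prop_irrelevance a1 b1) (Prop_irrelevance a2 b2)
    (Prop_irrelevance a3 b3).
case: mu nu => mu mu_out [nu nu_out] /= h; subst nu.
by rewrite (Prop_irrelevance mu_out nu_out).
Qed.

Section mk.
Variables (g : set T -> \bar R) (g0 : g set0 = 0%E).
Hypothesis gfin : forall E, measurable E -> g E \is a fin_num.
Hypothesis gsigma : semi_sigma_additive g.

Definition measurable_part (E : set T) : \bar R :=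
  if E \in measurable then g E else 0%E.

Lemma measurable_part0 : measurable_part set0 = 0%E.
Proof. by rewrite /measurable_part mem_set. Qed.

Lemma measurable_part_fin E : measurable E -> measurable_part E \is a fin_num.
Proof. by move=> mE; rewrite /measurable_part mem_set// gfin. Qed.

Lemma measurable_part_sigma : semi_sigma_additive measurable_part.
Proof.
move=> F mF tF mU; rewrite /measurable_part mem_set//.
under eq_fun do under eq_bigr do rewrite mem_set//.
exact: gsigma.
Qed.

HB.instance Definition _ :=
  isCharge.Build _ _ _ measurable_part
  measurable_part0 measurable_part_fin measurable_part_sigma.

Lemma measurable_part_out E : ~ measurable E -> measurable_part E = 0%E.
Proof. by move=> mE; rewrite /measurable_part memNset. Qed.

Definition mk_smeasure : smeasure := SMeasure measurable_part_out.

Lemma mk_smeasureE E : measurable E -> mk_smeasure E = g E.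
Proof. by move=> mE; rewrite /= /measurable_part mem_set. Qed.

End mk.

Definition smeasure0 : smeasure :=
  @SMeasure (@czero _ T R) (fun _ _ => erefl).

(* A Hahn decomposition is chosen; by [Hahn_decomposition_uniq] the variation and
   the two Jordan parts do not depend on the choice on measurable sets. *)
Definition hahn_pos (mu : smeasure) : set T := sval (cid (Hahn_decomposition mu)).

Definition hahn_neg (mu : smeasure) : set T :=
  sval (cid (svalP (cid (Hahn_decomposition mu)))).

Definition hahnP (mu : smeasure) :
    hahn_decomposition mu (hahn_pos mu) (hahn_neg mu) :=
  svalP (cid (svalP (cid (Hahn_decomposition mu)))).

Definition tv_norm (mu : smeasure) : R :=
  fine (charge_variation (hahnP mu) [set: T]).

(* [Rintegral] is a total operator: this is the Lebesgue integral whenever f is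
   integrable for |mu|, which is the case for the integrands [Ev E] and [id]
   used below, since they are bounded |mu|-almost everywhere for boundedly
   supported mu. *)
Definition sintegral (mu : smeasure) (f : T -> R) : R :=
  \int[jordan_pos (hahnP mu)]_x f x - \int[jordan_neg (hahnP mu)]_x f x.

Definition Ev (E : set T) (mu : smeasure) : R := fine (mu E).

Lemma EvE (mu : smeasure) E : measurable E -> (Ev E mu)%:E = mu E.
Proof. by move=> mE; rewrite /Ev fineK// fin_num_measure. Qed.

End smeasure.
Arguments smeasure0 {d T R}.
Arguments Ev {d T R}.
Arguments mk_smeasure {d T R g}.

Section smap.
Context d d' (T : measurableType d) (T' : measurableType d') (R : realType).
Variables (f : T -> T') (mf : measurable_fun [set: T] f).
Variable mu : smeasure T R.

Lemma mpre E : measurable E -> measurable (f @^-1` E).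
Proof. by move=> mE; rewrite -[X in measurable X]setTI; exact: mf. Qed.

Lemma smap0 : pushforward mu f set0 = 0%E.
Proof. by rewrite /pushforward preimage_set0 charge0. Qed.

Lemma smap_fin E : measurable E -> pushforward mu f E \is a fin_num.
Proof. by move=> mE; apply: (fin_num_measure mu); exact: mpre. Qed.

Lemma smap_sigma : semi_sigma_additive (pushforward mu f).
Proof.
move=> F mF tF mUF; rewrite /pushforward preimage_bigcup.
apply: charge_semi_sigma_additive.
- by move=> n; exact: mpre.
- apply/trivIsetP => /= i j _ _ ij; rewrite -preimage_setI.
  by move/trivIsetP : tF => /(_ _ _ _ _ ij) ->//; rewrite preimage_set0.
- by rewrite -preimage_bigcup; exact: mpre.
Qed.

Definition smap : smeasure T' R := mk_smeasure smap0 smap_fin smap_sigma.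

Lemma smapE E : measurable E -> smap E = mu (f @^-1` E).
Proof. exact: mk_smeasureE. Qed.

End smap.

Section sdirac.
Context d (T : measurableType d) (R : realType) (x : T).

Lemma dirac_fin (E : set T) : measurable E -> (\d_x E : \bar R) \is a fin_num.
Proof. by move=> _; rewrite diracE. Qed.

Definition sdirac : smeasure T R :=
  mk_smeasure (measure0 (\d_x)) dirac_fin (@measure_semi_sigma_additive _ _ _ _).

Lemma sdiracE E : measurable E -> sdirac E = \d_x E.
Proof. exact: mk_smeasureE. Qed.

End sdirac.

(* The subset A as a measurable space, with the trace sigma-algebra; a proof of
   nonemptiness is needed to obtain a [measurableType]. *)
Definition subset_type (T : Type) (A : set T) (a : T) (Aa : A a) : Type :=
  {x : T | A x}.

Definition incl (T : Type) (A : set T) (a : T) (Aa : A a) :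
  subset_type Aa -> T := sval.

Section subspace.
Context d (T : measurableType d) (A : set T) (a : T) (Aa : A a).

HB.instance Definition _ := gen_eqMixin (subset_type Aa).
HB.instance Definition _ := gen_choiceMixin (subset_type Aa).
HB.instance Definition _ := isPointed.Build (subset_type Aa) (exist A a Aa).

Definition subspace := g_sigma_algebra_preimageType (@incl T A a Aa).

End subspace.

Section supported.
Context d (T : measurableType d) (R : realType).

(* The first disjunct is the case of the empty subspace, whose only measure
   is 0 and which is not a [measurableType]. *)
Definition supported_by (mu : smeasure T R) (A : set T) : Prop :=
  (A = set0 /\ mu = smeasure0) \/
  (exists a (Aa : A a) (nu : smeasure (subspace Aa) R),
    forall E, measurable E ->
      mu E = pushforward nu (@incl T A a Aa : subspace Aa -> T) E).

Lemma supported_byP (mu : smeasure T R) A :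
  supported_by mu A <->
  (forall E, measurable E -> E `&` A = set0 -> mu E = 0%E).
Proof.
split=> [[[_ ->]//|[a [Aa [nu nuE]]]] E mE EA0|muA].
  rewrite nuE// /pushforward (_ : _ @^-1` _ = set0) ?charge0//.
  rewrite -subset0 => -[x Ax] /= Ex.
  by have : (E `&` A) x by []; rewrite EA0.
have [[a Aa]|/set0P/negP/negPn/eqP A0] := pselect (A !=set0); last first.
  left; split=> //; apply: smeasure_ext => E mE.
  by rewrite muA// A0 setI0.
right; exists a, Aa.
pose i : subspace Aa -> T := @incl T A a Aa.
have mi E : measurable E -> measurable (i @^-1` E).
  by move=> mE; exists E => //; rewrite setTI.
have muE E E' : measurable E -> measurable E' -> i @^-1` E = i @^-1` E' ->
    mu E = mu E'.
  move=> mE mE' EE'.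
  have h (B C : set T) : measurable B -> measurable C ->
      i @^-1` B = i @^-1` C -> mu B = mu (B `&` C).
    move=> mB mC BC; rewrite (chargeDI mu mB mC).
    suff -> : mu (B `\` C) = 0%E by rewrite add0e.
    apply: muA; first exact: measurableD.
    rewrite -subset0 => x [[Bx nCx] Ax]; apply: nCx.
    have : (i @^-1` B) (exist A x Ax) by [].
    by rewrite BC.
  by rewrite (h E E')// (h E' E)// setIC.
have Fex (F : set (subspace Aa)) : exists E,
    measurable F -> measurable E /\ i @^-1` E = F.
  have [[E mE <-]|nF] := pselect (measurable F).
    by exists E => _; rewrite setTI.
  by exists set0.
pose lft F := sval (cid (Fex F)).
have lftm F : measurable F -> measurable (lft F).
  by move=> mF; have [] := svalP (cid (Fex F)) mF.
have lftE F : measurable F -> i @^-1` (lft F) = F.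
  by move=> mF; have [] := svalP (cid (Fex F)) mF.
pose g F := mu (lft F).
have gE E : measurable E -> g (i @^-1` E) = mu E.
  move=> mE; apply: muE => //; first exact/lftm/mi.
  by rewrite lftE//; exact: mi.
have g0 : g set0 = 0%E by rewrite -(preimage_set0 i) gE ?charge0.
have gfin F : measurable F -> g F \is a fin_num.
  by move=> mF; exact/fin_num_measure/lftm.
have gsigma : semi_sigma_additive g.
  move=> F mF tF mU.
  pose G n := lft (F n).
  have mG n : measurable (G n) by exact: lftm.
  have FG n : F n = i @^-1` (seqDU G n).
    have -> : i @^-1` (seqDU G n) = F n `\` i @^-1` (\big[setU/set0]_(k < n) G k).
      by rewrite -[in RHS](lftE (F n)).
    apply/esym/setDidPl; rewrite -subset0 => x [Fx].
    rewrite /preimage/= -bigcup_mkord => -[k /= kn] Gk.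
    have Fk : F k x by rewrite -(lftE (F k)).
    move/trivIsetP : tF => /(_ k n Logic.I Logic.I).
    rewrite neq_ltn kn => /(_ isT) h.
    by have : (F k `&` F n) x by []; rewrite h.
  have mD n : measurable (seqDU G n).
    by apply: measurableD => //; exact: bigsetU_measurable.
  under eq_fun do under eq_bigr do rewrite FG gE//.
  rewrite (_ : \bigcup_n F n = i @^-1` (\bigcup_n seqDU G n)); last first.
    by rewrite preimage_bigcup; apply: eq_bigcupr => n _; exact: FG.
  have mUG : measurable (\bigcup_n seqDU G n) by exact: bigcupT_measurable.
  rewrite gE//; apply: charge_semi_sigma_additive => //.
exists (mk_smeasure g0 gfin gsigma) => E mE.
by rewrite /pushforward mk_smeasureE ?gE//; exact: mi.
Qed.

Lemma supported_byS (mu : smeasure T R) A B :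
  A `<=` B -> supported_by mu A -> supported_by mu B.
Proof.
move=> AB /supported_byP h; apply/supported_byP => E mE EB.
by apply: h => //; rewrite -subset0 -EB; exact: setIS.
Qed.

End supported.

Section MX.
Context (R : realType) (X : bornMeas).

Definition msmeasure : Type :=
  {mu : smeasure X R | exists2 B, bm_bounded X B & supported_by mu B}.

Definition msmeasure_val (mu : msmeasure) : smeasure X R := sval mu.
Coercion msmeasure_val : msmeasure >-> smeasure.

Lemma msmeasure_ext (mu nu : msmeasure) :
  (forall E, measurable E -> mu E = nu E) -> mu = nu.
Proof.
by move=> h; apply/eq_sig_hprop => [?|]; [exact: Prop_irrelevance|
  exact: smeasure_ext].
Qed.

Lemma msmeasure0_subproof :
  exists2 B, bm_bounded X B & supported_by (smeasure0 : smeasure X R) B.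
Proof. by exists set0; [exact: bounded_set0|left]. Qed.

Definition msmeasure0 : msmeasure := exist _ _ msmeasure0_subproof.

HB.instance Definition _ := gen_eqMixin msmeasure.
HB.instance Definition _ := gen_choiceMixin msmeasure.
HB.instance Definition _ := isPointed.Build msmeasure msmeasure0.

Definition Ev_preimages : set (set msmeasure) :=
  \bigcup_(E in @measurable _ X)
    preimage_set_system [set: msmeasure] (fun mu => Ev E mu)
      (@measurable _ R).

Definition Mspace := g_sigma_algebraType Ev_preimages.

Definition Mball (B : set X) (gamma : R) : set msmeasure :=
  [set mu | supported_by mu B /\ tv_norm mu <= gamma].

Definition Mbounded (A : set msmeasure) : Prop :=
  exists B gamma, [/\ bm_bounded X B, 0 <= gamma & A `<=` Mball B gamma].

Lemma Mbounded0 : Mbounded set0.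
Proof. by exists set0, 0; split => //; exact: bounded_set0. Qed.

Lemma MboundedS (A B : set msmeasure) : A `<=` B -> Mbounded B -> Mbounded A.
Proof.
move=> AB [C [gamma [bC g0 BC]]]; exists C, gamma; split => //.
exact: subset_trans BC.
Qed.

Lemma MboundedU (A B : set msmeasure) :
  Mbounded A -> Mbounded B -> Mbounded (A `|` B).
Proof.
move=> [A1 [g1 [bA1 g10 AA1]]] [B1 [g2 [bB1 g20 BB1]]].
exists (A1 `|` B1), (g1 + g2); split; [exact: bounded_setU|exact: addr_ge0|].
move=> mu [/AA1[sA le1]|/BB1[sB le2]]; split.
- by apply: supported_byS sA; exact: subsetUl.
- by rewrite (le_trans le1)// lerDl.
- by apply: supported_byS sB; exact: subsetUr.
- by rewrite (le_trans le2)// lerDr.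
Qed.

Lemma Mbounded1 (mu : msmeasure) : Mbounded [set mu].
Proof.
have [B bB sB] := svalP mu.
exists B, (tv_norm mu); split => //; last by move=> _ ->.
by rewrite /tv_norm fine_ge0.
Qed.

Definition M : bornMeas := @BornMeas _ Mspace
  (Bornology Mbounded0 MboundedS MboundedU Mbounded1).

End MX.

Section monad.
Context (R : realType).

Section Mmap.
Context (X Y : bornMeas) (f : X -> Y) (hf : is_bornMeas_mor f).

Lemma Mmap_subproof (mu : M R X) : exists2 B, bm_bounded Y B &
  supported_by (smap (proj1 hf) (mu : msmeasure R X)) B.
Proof.
have [B bB /supported_byP sB] := svalP (mu : msmeasure R X).
exists (f @` B); first exact: (proj2 hf).
apply/supported_byP => E mE EfB.
rewrite smapE// sB//.
- by rewrite -[X in measurable X]setTI; exact: (proj1 hf).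
- rewrite -subset0 => x [Efx Bx].
  have : (E `&` f @` B) (f x) by split=> //; exists x.
  by rewrite EfB.
Qed.

Definition Mmap (mu : M R X) : M R Y := exist _ _ (Mmap_subproof mu).

Lemma MmapE (mu : M R X) E : measurable E ->
  msmeasure_val (Mmap mu) E = msmeasure_val mu (f @^-1` E).
Proof. exact: smapE. Qed.

End Mmap.

Section Mdelta.
Context (X : bornMeas).

Lemma delta_subproof (x : X) : exists2 B, bm_bounded X B &
  supported_by (sdirac R x) B.
Proof.
exists [set x]; first exact: bounded_set1.
apply/supported_byP => E mE Ex; rewrite sdiracE// diracE memNset// => xE.
by have : (E `&` [set x]) x by []; rewrite Ex.
Qed.

Definition delta (x : X) : M R X := exist _ _ (delta_subproof x).

Lemma deltaE (x : X) E : measurable E -> msmeasure_val (delta x) E = \d_x E.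
Proof. exact: sdiracE. Qed.

End Mdelta.

Section Mkappa.
Context (X : bornMeas) (MM : M R (M R X)).

Local Notation charge_MM := (msmeasure_val (MM : msmeasure R (M R X))).

Definition EvM (E : set X) (mu : M R X) : R := Ev E (msmeasure_val mu).

Lemma measurable_EvM E : measurable E -> measurable_fun [set: M R X] (EvM E).
Proof.
move=> mE _ U mU; apply: sub_gen_smallest; exists E => //.
by exists U.
Qed.

Definition kappa_fun (E : set X) : \bar R := (sintegral charge_MM (EvM E))%:E.

Lemma EvM_tv E mu : measurable E -> `|EvM E mu| <= tv_norm (msmeasure_val mu).
Proof.
move=> mE; rewrite -lee_fin -abse_EFin EvE//.
rewrite /tv_norm fineK ?fin_num_measure//.
apply: le_trans (abse_charge_variation (hahnP _) mE) _.
by apply: le_measure; rewrite ?inE.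
Qed.

Lemma kappa0 : kappa_fun set0 = 0%E.
Proof.
rewrite /kappa_fun /sintegral (_ : EvM set0 = cst 0).
  by rewrite /Rintegral !integral0 subrr.
by apply/funext => mu; rewrite /EvM /Ev charge0.
Qed.

Lemma kappa_fin E : measurable E -> kappa_fun E \is a fin_num.
Proof. by []. Qed.

Lemma MM_bound : exists B gamma, [/\ bm_bounded X B, 0 <= gamma &
  supported_by charge_MM (Mball B gamma)].
Proof.
have [A [B [gamma [bB g0 AB]]] sA] := svalP (MM : msmeasure R (M R X)).
by exists B, gamma; split => //; exact: supported_byS sA.
Qed.

Lemma jordan_null B gamma (N : set (M R X)) :
  supported_by charge_MM (Mball B gamma) ->
  measurable N -> N `&` Mball B gamma = set0 ->
  jordan_pos (hahnP charge_MM) N = 0%E /\ jordan_neg (hahnP charge_MM) N = 0%E.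
Proof.
move=> /supported_byP sM mN NB.
have [[mP _] [mNg _] _ _] := hahnP charge_MM.
have h P : measurable P -> charge_MM (N `&` P) = 0%E.
  move=> mP'; apply: sM; first exact: measurableI.
  by rewrite setIAC NB set0I.
split.
  by rewrite jordan_posE cjordan_posE /crestr0 mem_set// /crestr h.
by rewrite jordan_negE cjordan_negE /crestr0 mem_set// /crestr h// oppe0.
Qed.

Lemma Rintegral_sigma (m : {finite_measure set (M R X) -> \bar R})
  (F : (set X)^nat) (N : set (M R X)) (gamma : R) :
  (forall i, measurable (F i)) -> trivIset setT F ->
  measurable N -> m N = 0%E ->
  (forall mu, ~ N mu -> [/\ forall n, `|EvM (F n) mu| <= gamma,
    forall n, `|EvM (\big[setU/set0]_(i < n) F i) mu| <= gamma &
    `|EvM (\bigcup_n F n) mu| <= gamma]) ->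
  (fun n => \sum_(0 <= i < n) (\int[m]_mu EvM (F i) mu)%:E)%E @ \oo -->
  (\int[m]_mu EvM (\bigcup_n F n) mu)%:E.
Proof.
move=> mF tF mN mN0 bnd.
have mUF : measurable (\bigcup_n F n) by exact: bigcupT_measurable.
have mEv E : measurable E -> measurable_fun [set: M R X] (EFin \o EvM E).
  by move=> mE; apply/measurable_EFinP; exact: measurable_EvM.
have ig : m.-integrable [set: M R X] (EFin \o cst gamma).
  exact: finite_measure_integrable_cst.
have iEv E : measurable E -> (forall mu, ~ N mu -> `|EvM E mu| <= gamma) ->
    m.-integrable [set: M R X] (EFin \o EvM E).
  move=> mE bE; apply/integrableP; split; first exact: mEv.
  apply: (@le_lt_trans _ _ (\int[m]_x `|(EFin \o cst gamma) x|)%E); last first.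
    by have /integrableP[] := ig.
  apply: ae_ge0_le_integral => //.
  - by apply: measurableT_comp => //; exact: mEv.
  - by apply: measurableT_comp => //; have /integrableP[] := ig.
  - exists N; split => // mu /=; apply: contra_notP => Nmu _.
    by rewrite lee_fin (le_trans (bE _ Nmu))// ler_norm.
pose f_ n (mu : M R X) := (\sum_(0 <= i < n) (EFin \o EvM (F i)) mu)%E.
have f_E n mu : f_ n mu = (EvM (\big[setU/set0]_(i < n) F i) mu)%:E.
  have mU : measurable (\big[setU/set0]_(i < n) F i).
    exact: bigsetU_measurable.
  rewrite /EvM EvE// charge_semi_additive// /f_ big_mkord.
  by apply: eq_bigr => i _; rewrite /= /EvM EvE.
have fE n : (\sum_(0 <= i < n) (\int[m]_mu EvM (F i) mu)%:E)%E =
    (\int[m]_mu f_ n mu)%E.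
  rewrite /f_ integral_sum//; last first.
    by move=> i; apply: iEv => // mu /bnd[].
  apply: eq_bigr => i _; rewrite /Rintegral fineK//.
  by apply: integrable_fin_num => //; apply: iEv => // mu /bnd[].
under eq_fun do rewrite fE.
rewrite /Rintegral fineK; last first.
  by apply: integrable_fin_num => //; apply: iEv => // mu /bnd[].
have [] := @dominated_convergence _ _ _ m setT measurableT f_
  (EFin \o EvM (\bigcup_n F n)) (EFin \o cst gamma) => //.
- move=> n; apply: (eq_measurable_fun (EFin \o EvM (\big[setU/set0]_(i < n) F i))).
    by move=> mu _; rewrite f_E.
  by apply: mEv; exact: bigsetU_measurable.
- exact: mEv.
- apply: aeW => mu _; rewrite /f_ /= /EvM EvE//.
  under eq_fun do under eq_bigr do rewrite EvE//.
  exact: charge_semi_sigma_additive.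
- exists N; split => // mu /=; apply: contra_notP => Nmu n _.
  by rewrite f_E lee_fin; have [] := bnd mu Nmu.
Qed.

Lemma kappa_sigma : semi_sigma_additive kappa_fun.
Proof.
move=> F mF tF mUF.
have [B [gamma [bB g0 sM]]] := MM_bound.
pose U n := \big[setU/set0]_(i < n) F i.
have mU n : measurable (U n) by exact: bigsetU_measurable.
pose N_ E := (EvM E) @^-1` [set r | gamma < `|r|].
have mN_ E : measurable E -> measurable (N_ E).
  move=> mE; rewrite -[X in measurable X]setTI; apply: measurable_EvM => //.
  rewrite -[X in measurable X]setTI.
  rewrite (_ : [set r | _] = Num.norm @^-1` `]gamma, +oo[%classic); last first.
    by apply/seteqP; split => r /=; rewrite in_itv/= andbT.
  by apply: normr_measurable => //; exact: measurable_itv.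
have N_B E mu : measurable E -> N_ E mu -> ~ Mball B gamma mu.
  move=> mE; rewrite /N_ /preimage/= => h [_ mug].
  by have := le_trans (EvM_tv mu mE) mug; rewrite leNgt h.
pose N := \bigcup_n N_ (F n) `|` \bigcup_n N_ (U n) `|` N_ (\bigcup_n F n).
have mN : measurable N.
  by apply: measurableU; [apply: measurableU|exact: mN_];
    apply: bigcupT_measurable => n; exact: mN_.
have NB : N `&` Mball B gamma = set0.
  by rewrite -subset0 => mu [[[[n _]|[n _]]|] /N_B]; exact.
have [p0 n0] := jordan_null sM mN NB.
have bnd mu : ~ N mu -> [/\ forall n, `|EvM (F n) mu| <= gamma,
    forall n, `|EvM (U n) mu| <= gamma & `|EvM (\bigcup_n F n) mu| <= gamma].
  move=> Nmu; split=> [n|n|]; rewrite leNgt; apply/negP => h; apply: Nmu.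
  - by left; left; exists n.
  - by left; right; exists n.
  - by right.
rewrite /kappa_fun /sintegral EFinB.
rewrite [X in X @ _](_ : _ = fun n =>
    (\sum_(0 <= i < n) (\int[jordan_pos (hahnP charge_MM)]_mu EvM (F i) mu)%:E -
     \sum_(0 <= i < n) (\int[jordan_neg (hahnP charge_MM)]_mu EvM (F i) mu)%:E)%E).
  by apply: cvgeB => //; exact: (Rintegral_sigma mF tF mN _ bnd).
by apply/funext => n; rewrite !sumEFin -EFinB sumrB.
Qed.

Lemma kappa_subproof : exists2 B, bm_bounded X B &
  supported_by (mk_smeasure kappa0 kappa_fin kappa_sigma) B.
Proof.
have [B [gamma [bB g0 sM]]] := MM_bound.
exists B => //; apply/supported_byP => E mE EB.
rewrite mk_smeasureE// /kappa_fun /sintegral.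
pose N := (EvM E) @^-1` (~` [set 0]).
have mN : measurable N.
  rewrite -[N]setTI; apply: measurable_EvM => //.
  by apply: measurableC; exact: measurable_set1.
have NB : N `&` Mball B gamma = set0.
  rewrite -subset0 => mu [Nmu [/supported_byP smu _]]; apply: Nmu => /=.
  by rewrite /EvM /Ev smu.
have [p0 n0] := jordan_null sM mN NB.
have h (m : {measure set (M R X) -> \bar R}) : m N = 0%E ->
    \int[m]_mu EvM E mu = 0.
  move=> mN0; rewrite /Rintegral (ae_eq_integral (cst 0%E))//.
  - by rewrite integral0.
  - by apply/measurable_EFinP; exact: measurable_EvM.
  - exists N; split => // mu /= /not_implyP[_] /eqP; rewrite eqe => /eqP.
    by [].
by rewrite !h// subrr.
Qed.

Definition kappa : M R X := exist _ _ kappa_subproof.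

Lemma kappaE E : measurable E ->
  msmeasure_val kappa E = (sintegral charge_MM (EvM E))%:E.
Proof. exact: mk_smeasureE. Qed.

End Mkappa.

End monad.

Section malgebra.
Context (R : realType).

Definition is_malgebra (X : bornMeas) (c : M R X -> X) : Prop :=
  exists hc : is_bornMeas_mor c,
    c \o delta R (X := X) = id /\ c \o Mmap hc = c \o kappa (X := X).

Definition is_mhom (X Y : bornMeas) (c : M R X -> X) (d : M R Y -> Y)
    (phi : X -> Y) : Prop :=
  exists hphi : is_bornMeas_mor phi, phi \o c = d \o Mmap hphi.

Definition malg_isomorphic (X Y : bornMeas) (c : M R X -> X)
    (d : M R Y -> Y) : Prop :=
  exists (phi : X -> Y) (psi : Y -> X),
    [/\ is_mhom c d phi, is_mhom d c psi, psi \o phi = id & phi \o psi = id].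

End malgebra.

Section real_line.
Context (R : realType).

Lemma RboundedP (A : set R) :
  bounded_set A <-> exists r : R, forall x, A x -> `|x| <= r.
Proof.
split=> [/ex_strict_bound_gt0[r _ Ar]|[r Ar]].
  by exists r => x Ax; exact/ltW/Ar.
exists r; split=> [|s rs x Ax]; first exact: num_real.
exact: le_trans (Ar x Ax) (ltW rs).
Qed.

Lemma Rbounded0 : bounded_set (set0 : set R).
Proof. by apply/RboundedP; exists 0. Qed.

Lemma RboundedS (A B : set R) : A `<=` B -> bounded_set B -> bounded_set A.
Proof.
by move=> AB /RboundedP[r Br]; apply/RboundedP; exists r => x /AB; exact: Br.
Qed.

Lemma RboundedU (A B : set R) :
  bounded_set A -> bounded_set B -> bounded_set (A `|` B).
Proof.
move=> /RboundedP[r Ar] /RboundedP[s Bs]; apply/RboundedP.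
exists (Num.max r s) => x [/Ar|/Bs] h; rewrite le_max h//.
by rewrite orbT.
Qed.

Lemma Rbounded1 (x : R) : bounded_set [set x].
Proof. by apply/RboundedP; exists `|x| => _ ->. Qed.

Definition real_bornMeas : bornMeas :=
  @BornMeas _ R (Bornology Rbounded0 RboundedS RboundedU Rbounded1).

Definition c_real (mu : M R real_bornMeas) : real_bornMeas :=
  sintegral (msmeasure_val mu) (id : R -> R).

End real_line.

Definition one_bornMeas : bornMeas :=
  @BornMeas _ unit (@Bornology unit setT I (fun _ _ _ _ => I)
    (fun _ _ _ _ => I) (fun=> I)).

(* Main.v *)
Require Import Defs.
From mathcomp Require Import all_boot all_order all_algebra.
From mathcomp Require Import all_classical all_reals all_analysis.
From mathcomp Require Import measurable_realfun ring lra.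

Set Implicit Arguments.
Unset Strict Implicit.
Unset Printing Implicit Defensive.

Import Order.TTheory GRing.Theory Num.Theory.
Import numFieldNormedType.Exports.

Local Open Scope classical_set_scope.
Local Open Scope ring_scope.

(** Each identity needed below compares two ways of integrating a function [g]
    against signed measures with bounded support. Both sides are linear in [g]
    and continuous for the supremum norm, and they agree almost by definition
    when [g] is the indicator of a measurable set. Since
    bounded measurable functions are uniform limits of linear combinations of
    indicators, this proves each identity for all bounded measurable [g]
    ([bounded_measurable_ind]). Bornological functions to the reals, such as the
    identity, need not be bounded, but only their values on a bounded support
    matter ([sintegral_eq_on]), so they may be replaced by a truncation [clamp].

    Two such identities carry the algebra structure. The first is the change of
    variables [int g d(f_* mu) = int (g o f) dmu] ([sintegral_smap]); it says in
    particular that [c_R (Mg mu) = int g dmu] for [g : X -> R]. The second is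
    the Fubini-type formula
    [int g d(kappa MM) = int (int g dmu) dMM(mu)] ([sintegral_kappa]). For
    [g = id] the right-hand side is [int c_R dMM], which is [c_R (M c_R MM)] by
    the first identity: this is the associativity law. That [c_R] is a morphism
    follows from [|int g dmu| <= sup |g| * ||mu||] for boundedness, and, for
    measurability, from one more use of the same induction.

    On the one-point space a signed measure is the same thing as its total mass,
    so [mass : M1 -> R] and [t |-> t delta] are inverse to each other. The
    evaluation of [kappa MM] at the whole space is by definition the integral
    of [mass], which is [c_R (M mass MM)]: so [mass] is a homomorphism, and then
    so is its inverse. *)

(* The integral against a signed measure, not that of a simple function. *)
Local Notation sintegral := Defs.sintegral.

(** * Bounded measurable functions *)

Section bounded_measurable.
Context d (T : measurableType d) (R : realType).

Definition bounded_measurable (f : T -> R) : Prop :=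
  measurable_fun [set: T] f /\ exists r : R, forall x, `|f x| <= r.

Lemma bounded_measurable_indic E : measurable E -> bounded_measurable \1_E.
Proof.
move=> mE; split; first exact: measurable_indic.
by exists 1 => x; rewrite indicE; case: (_ \in _); rewrite ?normr1 ?normr0.
Qed.

Lemma bounded_measurable_cst (a : R) : bounded_measurable (cst a).
Proof. by split; [exact: measurable_cst|exists `|a|]. Qed.

Lemma bounded_measurable_lin a f g : bounded_measurable f ->
  bounded_measurable g -> bounded_measurable (fun x => a * f x + g x).
Proof.
move=> [mf [r fr]] [mg [s gs]]; split.
  by apply: measurable_funD => //; apply: measurable_funM.
exists (`|a| * r + s) => x.
by rewrite (le_trans (ler_normD _ _))// lerD// normrM ler_wpM2l.
Qed.

(** A function with values in [0, 1] is approximated through its binary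
    expansion: if [E] is the set where [f >= 1/2], then [f = (1_E + g) / 2] with
    [g = 2 f - 1_E] again valued in [0, 1], so that each digit extracted halves
    the error. The general case follows by an affine rescaling. *)
Lemma bounded_measurable_ind (P : (T -> R) -> Prop) :
  (forall E, measurable E -> P \1_E) ->
  (forall a f g, bounded_measurable f -> bounded_measurable g ->
    P f -> P g -> P (fun x => a * f x + g x)) ->
  (forall f, bounded_measurable f ->
    (forall e : R, 0 < e -> exists s,
      [/\ bounded_measurable s, P s & forall x, `|f x - s x| <= e]) -> P f) ->
  forall f, bounded_measurable f -> P f.
Proof.
move=> Pind Plin Plim.
have P0 : P (cst 0) by rewrite -indic0; exact: Pind.
have dyadic n : forall f : T -> R, measurable_fun [set: T] f ->
    (forall x, 0 <= f x <= 1) -> exists s,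
    [/\ bounded_measurable s, P s & forall x, `|f x - s x| <= 2^-1 ^+ n].
  elim: n => [|n IHn] f mf f01.
    exists (cst 0); split; [exact: bounded_measurable_cst|exact: P0|move=> x].
    by rewrite subr0 ger0_norm; case/andP: (f01 x).
  pose E := f @^-1` `[2^-1, +oo[%classic.
  have mE : measurable E.
    by rewrite -[E]setTI; apply: mf => //; exact: measurable_itv.
  have [bE PE] := (bounded_measurable_indic mE, Pind _ mE).
  have [||s [bs Ps gs]] := IHn (fun x => 2 * f x - \1_E x).
  - apply: measurable_funB; last exact: measurable_indic.
    exact: measurable_funM.
  - move=> x; have := f01 x; rewrite indicE /E.
    have [|] := boolP (x \in _).
      by rewrite inE /= in_itv/= andbT => ?; lra.
    by rewrite notin_setE /= in_itv/= andbT => /negP; rewrite -ltNge; lra.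
  have bh := bounded_measurable_lin 2^-1 bs (bounded_measurable_cst 0).
  exists (fun x => 2^-1 * \1_E x + (2^-1 * s x + cst 0 x)); split.
  - exact: bounded_measurable_lin.
  - apply: (Plin) => //; apply: (Plin) => //; exact: bounded_measurable_cst.
  - move=> x /=; have := gs x; rewrite exprS.
    rewrite (_ : f x - _ = 2^-1 * (2 * f x - \1_E x - s x)); last by field.
    rewrite normrM (ger0_norm (_ : 0 <= 2^-1)) ?invr_ge0//.
    by rewrite ler_pM2l ?invr_gt0.
have P01 (f : T -> R) : measurable_fun [set: T] f ->
    (forall x, 0 <= f x <= 1) -> P f.
  move=> mf f01; apply: Plim.
    split=> //; exists 1 => x.
    by rewrite ger0_norm; case/andP: (f01 x).
  move=> e e0.
  have [n ne] : exists n, 2^-1 ^+ n < e :> R.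
    have : (2^-1 : R) ^+ n @[n --> \oo] --> (0 : R).
      by apply: cvg_expr; rewrite ger0_norm ?invr_ge0// invf_lt1 ?ltr1n.
    move=> /cvgrPdist_lt/(_ e e0)[n _ /(_ n (leqnn n))] /=.
    by rewrite sub0r normrN ger0_norm ?exprn_ge0 ?invr_ge0//; exists n.
  have [s [bs Ps fs]] := dyadic n f mf f01.
  by exists s; split => // x; rewrite (le_trans (fs x))// ltW.
move=> f [mf [r fr]].
(* The maximum ensures that the scaling factor is invertible. *)
pose c := Num.max r 1; have c0 : 0 < c by rewrite lt_max ltr01 orbT.
have fc x : `|f x| <= c by rewrite le_max fr.
pose g x := (2 * c)^-1 * (f x + c).
have g01 x : 0 <= g x <= 1.
  move: (fc x); rewrite ler_norml /g => /andP[fc1 fc2].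
  rewrite mulr_ge0 ?invr_ge0; [|lra|lra].
  by rewrite mulrC ler_pdivrMr; lra.
have mg : measurable_fun [set: T] g.
  by apply: measurable_funM => //; exact: measurable_funD.
have bg : bounded_measurable g.
  by split=> //; exists 1 => x; rewrite ger0_norm; case/andP: (g01 x).
rewrite (_ : f = fun x => 2 * c * g x + (- c * \1_setT x + cst 0 x)).
  have b1 := bounded_measurable_indic (@measurableT _ T).
  have b0 := bounded_measurable_cst 0.
  apply: (Plin) => //; first exact: bounded_measurable_lin.
    exact: P01.
  by apply: Plin => //; exact: Pind.
apply/funext => x; rewrite /g indicE in_setT /=.
by field; rewrite lt0r_neq0.
Qed.

End bounded_measurable.
(** * Integration against a signed measure *)

Section signed_integral.
Context d (T : measurableType d) (R : realType).
Implicit Types (mu : smeasure T R) (B E N : set T) (f g : T -> R) (a r s : R).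

Local Notation jpos mu := (jordan_pos (hahnP mu)).
Local Notation jneg mu := (jordan_neg (hahnP mu)).

(** Both Jordan parts are restrictions of [mu], up to sign, to the pieces of a
    Hahn decomposition, so they vanish where [mu] does hereditarily. *)
Lemma supported_null mu B N : supported_by mu B -> measurable N ->
  N `&` B = set0 -> jpos mu N = 0%E /\ jneg mu N = 0%E.
Proof.
move=> /supported_byP sM mN NB.
have [[mP _] [mNg _] _ _] := hahnP mu.
have h P : measurable P -> mu (N `&` P) = 0%E.
  move=> mP'; apply: sM; first exact: measurableI.
  by rewrite setIAC NB set0I.
split.
  by rewrite jordan_posE cjordan_posE /crestr0 mem_set// /crestr h.
by rewrite jordan_negE cjordan_negE /crestr0 mem_set// /crestr h// oppe0.
Qed.

Lemma supported_by_T mu : supported_by mu [set: T].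
Proof.
by apply/supported_byP => E mE; rewrite setIT => ->; rewrite charge0.
Qed.

Lemma tv_normE mu : tv_norm mu = fine (jpos mu setT) + fine (jneg mu setT).
Proof. by rewrite /tv_norm fineD ?fin_num_measure. Qed.

Section ess_bounded.
Variables (m : {finite_measure set T -> \bar R}) (f : T -> R).
Variables (N : set T) (r : R).
Hypotheses (mf : measurable_fun [set: T] f) (mN : measurable N).
Hypotheses (N0 : m N = 0%E) (fr : forall x, ~ N x -> `|f x| <= r).

Lemma ess_bounded_integrable : m.-integrable [set: T] (EFin \o f).
Proof.
have mcst : m.-integrable [set: T] (EFin \o cst r).
  exact: finite_measure_integrable_cst.
apply/integrableP; split; first exact/measurable_EFinP.
apply: (@le_lt_trans _ _ (\int[m]_x `|(EFin \o cst r) x|)%E); last first.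
  by have /integrableP[] := mcst.
apply: ae_ge0_le_integral => //.
- by apply: measurableT_comp => //; exact/measurable_EFinP.
- by apply: measurableT_comp => //; have /integrableP[] := mcst.
- exists N; split => // x /=; apply: contra_notP => Nx _.
  by rewrite lee_fin (le_trans (fr Nx))// ler_norm.
Qed.

Lemma ess_bounded_le : 0 <= r -> `|\int[m]_x f x| <= r * fine (m setT).
Proof.
move=> r0; rewrite (le_trans (le_normr_Rintegral _ ess_bounded_integrable))//.
rewrite -Rintegral_cst// /Rintegral fine_le//.
- apply: integrable_fin_num => //.
  exact: integrable_norm ess_bounded_integrable.
- by apply: integrable_fin_num => //; exact: finite_measure_integrable_cst.
- apply: ae_ge0_le_integral => //.
  + apply/measurable_EFinP; exact: measurableT_comp.
  + exists N; split => // x /=; apply: contra_notP => Nx _.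
    by rewrite lee_fin; exact: fr.
Qed.

End ess_bounded.

(** The support [B] need not be measurable; the set where a bound valid on [B]
    fails is, and it is a null set for both Jordan parts. *)
Lemma bounded_on_null mu B f r : supported_by mu B ->
  measurable_fun [set: T] f -> (forall x, B x -> `|f x| <= r) ->
  exists N, [/\ measurable N, jpos mu N = 0%E, jneg mu N = 0%E &
    forall x, ~ N x -> `|f x| <= r].
Proof.
move=> sB mf fr; pose N := f @^-1` [set s | r < `|s|].
have mN : measurable N.
  rewrite -[N]setTI; apply: mf => //.
  rewrite (_ : [set s | _] = Num.norm @^-1` `]r, +oo[%classic); last first.
    by apply/seteqP; split => s /=; rewrite in_itv/= andbT.
  by rewrite -[X in measurable X]setTI; apply: normr_measurable.
have [] := supported_null sB mN.
  by rewrite -subset0 => x [/= rf /fr]; rewrite leNgt => /negP; apply.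
by exists N; split => // x /negP; rewrite -leNgt.
Qed.

Lemma supported_integrable mu B f r : supported_by mu B ->
  measurable_fun [set: T] f -> (forall x, B x -> `|f x| <= r) ->
  (jpos mu).-integrable [set: T] (EFin \o f) /\
  (jneg mu).-integrable [set: T] (EFin \o f).
Proof.
move=> sB mf /(bounded_on_null sB mf)[N [mN Np Nn fr]].
split; first exact: (ess_bounded_integrable mf mN Np fr).
exact: (ess_bounded_integrable mf mN Nn fr).
Qed.

Lemma normr_sintegral_le mu B f r : supported_by mu B ->
  measurable_fun [set: T] f -> 0 <= r -> (forall x, B x -> `|f x| <= r) ->
  `|sintegral mu f| <= r * tv_norm mu.
Proof.
move=> sB mf r0 /(bounded_on_null sB mf)[N [mN Np Nn fr]].
rewrite tv_normE mulrDr (le_trans (ler_normB _ _))// lerD//.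
  exact: (ess_bounded_le mf mN Np fr r0).
exact: (ess_bounded_le mf mN Nn fr r0).
Qed.

Lemma sintegral_eq_on mu B f g : supported_by mu B ->
  measurable_fun [set: T] f -> measurable_fun [set: T] g ->
  (forall x, B x -> f x = g x) -> sintegral mu f = sintegral mu g.
Proof.
move=> sB mf mg fg.
have [N [mN Np Nn h]] : exists N, [/\ measurable N, jpos mu N = 0%E,
    jneg mu N = 0%E & forall x, ~ N x -> `|f x - g x| <= 0].
  apply: (bounded_on_null sB); first exact: measurable_funB.
  by move=> x /fg ->; rewrite subrr normr0.
have eq_int (m : {measure set T -> \bar R}) : m N = 0%E ->
    \int[m]_x f x = \int[m]_x g x.
  move=> mN0; rewrite /Rintegral; congr fine; apply: ae_eq_integral => //.
  - exact/measurable_EFinP.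
  - exact/measurable_EFinP.
  - exists N; split => // x /=; apply: contra_notP => /h.
    by rewrite normr_le0 subr_eq0 => /eqP -> _.
by rewrite /sintegral !eq_int.
Qed.

Lemma sintegral_lin mu B a f g r s : supported_by mu B ->
  measurable_fun [set: T] f -> measurable_fun [set: T] g ->
  (forall x, B x -> `|f x| <= r) -> (forall x, B x -> `|g x| <= s) ->
  sintegral mu (fun x => a * f x + g x) = a * sintegral mu f + sintegral mu g.
Proof.
move=> sB mf mg fr gs.
have [fp fn] := supported_integrable sB mf fr.
have [gp gn] := supported_integrable sB mg gs.
have lin (m : {measure set T -> \bar R}) : m.-integrable setT (EFin \o f) ->
    m.-integrable setT (EFin \o g) ->
    \int[m]_x (a * f x + g x) = a * \int[m]_x f x + \int[m]_x g x.
  move=> fi gi; rewrite RintegralD//; first by rewrite RintegralZl.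
  rewrite (_ : EFin \o _ = (fun x => a%:E * (EFin \o f) x)%E)//.
  exact: integrableZl.
rewrite /sintegral !lin//; ring.
Qed.

Lemma sintegral_indic mu E : measurable E -> sintegral mu \1_E = Ev E mu.
Proof.
move=> mE; rewrite /sintegral /Rintegral !integral_indic// !setIT.
rewrite /Ev (jordan_decomp (hahnP mu) mE) /cadd/= /cscale/=.
rewrite fineD ?fin_numM ?fin_num_measure//.
by rewrite mulN1e fineN.
Qed.

Lemma sintegral_cst mu a : sintegral mu (cst a) = a * Ev setT mu.
Proof.
rewrite -sintegral_indic//.
have bT (x : T) : setT x -> `|cst 0 x : R| <= 0 by move=> _; rewrite normr0.
rewrite (_ : cst a = fun x => a * \1_setT x + cst 0 x); last first.
  by apply/funext => x; rewrite indicE in_setT mulr1 addr0.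
rewrite (@sintegral_lin mu setT _ _ _ 1 0)//.
- by rewrite /sintegral !Rintegral_cst// !mul0r subrr addr0.
- exact: supported_by_T.
- by move=> x _; rewrite indicE in_setT normr1.
Qed.

(** The norm is [mu P - mu N] for a Hahn decomposition [(P, N)]. *)
Lemma tv_norm_le mu C : (forall E, measurable E -> `|Ev E mu| <= C) ->
  tv_norm mu <= 2 * C.
Proof.
move=> muC; have [[mP _] [mNg _] _ _] := hahnP mu.
rewrite tv_normE mulr2n mulrDl mul1r; apply: lerD.
  rewrite jordan_posE cjordan_posE /crestr0 mem_set// /crestr setTI.
  exact: le_trans (ler_norm _) (muC _ mP).
rewrite jordan_negE cjordan_negE /crestr0 mem_set// /crestr setTI fineN.
by rewrite (le_trans _ (muC _ mNg))// -normrN ler_norm.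
Qed.

End signed_integral.
(** * Truncation and approximation *)

Section clamp.
Context (R : realType).
Implicit Types (r x : R).

Definition clamp r x : R := Num.max (- r) (Num.min x r).

Lemma clamp_id r x : `|x| <= r -> clamp r x = x.
Proof.
by rewrite ler_norml /clamp => /andP[? ?]; rewrite min_l// max_r.
Qed.

Lemma normr_clamp_le r x : 0 <= r -> `|clamp r x| <= r.
Proof.
move=> r0; rewrite ler_norml /clamp le_max lexx/= ge_max ge_min lexx orbT andbT.
by lra.
Qed.

Lemma measurable_clamp r : measurable_fun [set: R] (clamp r).
Proof. by apply: measurable_maxr => //; exact: measurable_minr. Qed.

Lemma bounded_measurable_clamp d (T : measurableType d) (f : T -> R) r :
  0 <= r -> measurable_fun [set: T] f -> bounded_measurable (clamp r \o f).
Proof.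
move=> r0 mf; split; last by exists r => x; exact: normr_clamp_le.
by apply: measurableT_comp => //; exact: measurable_clamp.
Qed.

End clamp.

Section approximation.
Context d (T : measurableType d) (R : realType).

Lemma bounded_measurable_ge0 (f : T -> R) : bounded_measurable f ->
  exists2 r : R, 0 <= r & forall x, `|f x| <= r.
Proof.
move=> [_ [r fr]]; exists `|r| => // x.
by rewrite (le_trans (fr x))// ler_norm.
Qed.

Lemma sintegral_approx (mu : smeasure T R) B (f s : T -> R) (r r' e : R) :
  supported_by mu B ->
  measurable_fun [set: T] f -> measurable_fun [set: T] s ->
  (forall x, B x -> `|f x| <= r) -> (forall x, B x -> `|s x| <= r') ->
  0 <= e -> (forall x, B x -> `|f x - s x| <= e) ->
  `|sintegral mu f - sintegral mu s| <= e * tv_norm mu.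
Proof.
move=> sB mf ms fr sr e0 fs.
have -> : sintegral mu f - sintegral mu s =
    sintegral mu (fun x => -1 * s x + f x).
  by rewrite (sintegral_lin _ sB ms mf sr fr) mulN1r addrC.
apply: (normr_sintegral_le sB) => //.
  by apply: measurable_funD => //; exact: measurable_funM.
by move=> x /fs; rewrite mulN1r addrC.
Qed.

Lemma sintegral_lin_bounded (mu : smeasure T R) a f g :
  bounded_measurable f -> bounded_measurable g ->
  sintegral mu (fun x => a * f x + g x) = a * sintegral mu f + sintegral mu g.
Proof.
move=> [mf [r fr]] [mg [s gs]].
exact: (sintegral_lin _ (@supported_by_T _ _ _ mu) mf mg
  (fun x _ => fr x) (fun x _ => gs x)).
Qed.

Lemma sintegral_approx_bounded (mu : smeasure T R) f s e :
  bounded_measurable f -> bounded_measurable s ->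
  0 <= e -> (forall x, `|f x - s x| <= e) ->
  `|sintegral mu f - sintegral mu s| <= e * tv_norm mu.
Proof.
move=> [mf [r fr]] [ms [r' sr]] e0 fs.
exact: (sintegral_approx (@supported_by_T _ _ _ mu) mf ms
  (fun x _ => fr x) (fun x _ => sr x)).
Qed.

Lemma bounded_measurable_comp d' (U : measurableType d') (f : T -> U)
    (g : U -> R) : measurable_fun [set: T] f -> bounded_measurable g ->
  bounded_measurable (g \o f).
Proof.
move=> mf [mg [r gr]]; split; first exact: measurableT_comp.
by exists r => x; exact: gr.
Qed.

End approximation.

Lemma eq_of_norm_le (R : realType) (a b C : R) :
  (forall e : R, 0 < e -> `|a - b| <= e * C) -> a = b.
Proof.
move=> h; apply/eqP; rewrite -subr_eq0 -normr_le0; apply/ler_addgt0Pr => e e0.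
have C0 : 0 < `|C| + 1 by rewrite ltr_wpDl.
rewrite add0r (le_trans (h (e / (`|C| + 1)) _))// ?divr_gt0//.
rewrite mulrAC ler_pdivrMr// ler_pM2l// (le_trans (ler_norm _))//.
by rewrite lerDl.
Qed.

(** * Change of variables *)

Section change_of_variables.
Context d d' (T : measurableType d) (U : measurableType d') (R : realType).
Variables (f : T -> U) (mf : measurable_fun [set: T] f) (mu : smeasure T R).

(** The Jordan parts of the image measure are not the images of the Jordan parts,
    because of cancellations, so the formula is not inherited from the one for
    positive measures; it is checked on indicators instead. *)
Lemma sintegral_smap_bounded (g : U -> R) : bounded_measurable g ->
  sintegral (smap mf mu) g = sintegral mu (g \o f).
Proof.
move: g; apply: bounded_measurable_ind => [E mE|a g h bg bh Eg Eh|g bg happ].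
- rewrite sintegral_indic// /Ev smapE//.
  rewrite (_ : \1_E \o f = \1_(f @^-1` E)); last first.
    by apply/funext => x; rewrite /= !indicE.
  by rewrite sintegral_indic//; exact: mpre.
- rewrite sintegral_lin_bounded// Eg Eh.
  by rewrite -sintegral_lin_bounded//; exact: bounded_measurable_comp.
(* Pass to the limit: both sides differ from their values at [s] by at most
   [e] times a total variation. *)
- apply: (@eq_of_norm_le _ _ _ (tv_norm (smap mf mu) + tv_norm mu)) => e e0.
  have [s [bs Es gs]] := happ e e0.
  rewrite -[X in `|X|](subrKA (sintegral (smap mf mu) s)) mulrDr.
  rewrite (le_trans (ler_normD _ _))// lerD//.
    by apply: sintegral_approx_bounded => //; exact: ltW.
  rewrite Es distrC.
  apply: sintegral_approx_bounded;
    [exact: bounded_measurable_comp..|exact: ltW|].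
  by move=> x; exact: gs.
Qed.

Lemma supported_smap B : supported_by mu B -> supported_by (smap mf mu) (f @` B).
Proof.
move=> /supported_byP sB; apply/supported_byP => E mE EfB.
rewrite smapE// sB//; first exact: mpre.
rewrite -subset0 => x [Efx Bx].
have : (E `&` f @` B) (f x) by split=> //; exists x.
by rewrite EfB.
Qed.

Lemma sintegral_smap B r (g : U -> R) : supported_by mu B -> 0 <= r ->
  measurable_fun [set: U] g -> (forall x, B x -> `|g (f x)| <= r) ->
  sintegral (smap mf mu) g = sintegral mu (g \o f).
Proof.
move=> sB r0 mg gr.
have [mc _] := bounded_measurable_clamp r0 mg.
rewrite (sintegral_eq_on (supported_smap sB) mg mc); last first.
  by move=> _ [x Bx <-]; rewrite /= clamp_id// gr.
rewrite sintegral_smap_bounded; last exact: bounded_measurable_clamp.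
apply: (sintegral_eq_on sB).
- exact: measurableT_comp.
- exact: measurableT_comp.
- by move=> x Bx; rewrite /= clamp_id// gr.
Qed.

End change_of_variables.

(** * Integration of bornological functions and Fubini's formula *)

Section fubini.
Context (R : realType) (X : bornMeas).

Lemma measurable_sintegral_bounded (g : X -> R) : bounded_measurable g ->
  measurable_fun [set: M R X] (fun mu : M R X => sintegral (msmeasure_val mu) g).
Proof.
move: g; apply: bounded_measurable_ind => [E mE|a g h bg bh Eg Eh|g bg happ].
- under eq_fun do rewrite sintegral_indic//.
  exact: measurable_EvM.
- under eq_fun do rewrite sintegral_lin_bounded//.
  by apply: measurable_funD => //; exact: measurable_funM.
- have inv0 n : 0 < n.+1%:R^-1 :> R by rewrite invr_gt0.
  have [s_ s_P] := choice (fun n => happ _ (inv0 n)).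
  apply: (@measurable_fun_cvg _ _ _ _
    (fun n (mu : M R X) => sintegral (msmeasure_val mu) (s_ n))).
    by move=> n; have [] := s_P n.
  move=> mu _.
  apply/cvgrPdist_le => e e0; near=> n.
  have [bs _ gs] := s_P n.
  rewrite (le_trans (sintegral_approx_bounded _ bg bs _ gs))//.
  rewrite mulrC ler_pdivrMr// -ler_pdivrMl//.
  rewrite (@le_trans _ _ n%:R) ?ler_nat//.
  near: n; exact: nbhs_infty_ger.
Unshelve. all: by end_near. Qed.

Lemma msmeasure_supported (mu : M R X) :
  exists2 B, bm_bounded X B & supported_by (msmeasure_val mu) B.
Proof. exact: svalP mu. Qed.

Lemma bounded_on_real (g : X -> real_bornMeas R) B :
  is_bornMeas_mor g -> bm_bounded X B ->
  exists2 r : R, 0 <= r & forall x, B x -> `|g x : R| <= r.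
Proof.
move=> [_ bg] /bg /RboundedP[r gr]; exists `|r| => // x Bx.
by rewrite (le_trans (gr _ _))// ?ler_norm//; exists x.
Qed.

(** For fixed [mu] the integrals of the truncations of [g] at height [n] are
    eventually constant, although no [n] suits all [mu] at once. *)
Lemma measurable_sintegral (g : X -> real_bornMeas R) : is_bornMeas_mor g ->
  measurable_fun [set: M R X]
    (fun mu : M R X => sintegral (msmeasure_val mu) (g : X -> R)).
Proof.
move=> hg; have [mg _] := hg.
apply: (@measurable_fun_cvg _ _ _ _
  (fun n (mu : M R X) => sintegral (msmeasure_val mu) (clamp n%:R \o (g : X -> R)))).
  move=> n; apply: measurable_sintegral_bounded.
  exact: bounded_measurable_clamp.
move=> mu _; have [B bB sB] := msmeasure_supported mu.
have [r r0 gr] := bounded_on_real hg bB.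
apply/cvgrPdist_le => e e0; near=> n.
rewrite (@sintegral_eq_on _ _ _ _ B g (clamp n%:R \o (g : X -> R)))//.
- by rewrite subrr normr0 ltW.
- by have [] := @bounded_measurable_clamp _ _ _ (g : X -> R) n%:R (ler0n _ _) mg.
- move=> x Bx; rewrite /= clamp_id//.
  rewrite (le_trans (gr x Bx))//.
  near: n; exact: nbhs_infty_ger.
Unshelve. all: by end_near. Qed.

Lemma bornMeas_sintegral (g : X -> real_bornMeas R) : is_bornMeas_mor g ->
  is_bornMeas_mor
    (fun mu : M R X => sintegral (msmeasure_val mu) (g : X -> R) : real_bornMeas R).
Proof.
move=> hg; split; first exact: measurable_sintegral.
move=> A [B [gamma [bB g0 AB]]].
have [r r0 gr] := bounded_on_real hg bB.
apply/RboundedP; exists (r * gamma) => _ [mu /AB [sB le] <-].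
rewrite (le_trans (normr_sintegral_le sB (proj1 hg) r0 gr))//.
exact: ler_wpM2l.
Qed.

Variable MM : M R (M R X).
Local Notation mm := (msmeasure_val MM).

Lemma kappa_supported B gamma : supported_by mm (Mball B gamma) ->
  supported_by (msmeasure_val (kappa MM)) B.
Proof.
move=> sM; apply/supported_byP => E mE EB; rewrite kappaE//.
rewrite (@sintegral_eq_on _ _ _ _ _ _ (cst 0) sM)//.
- by rewrite sintegral_cst mul0r.
- exact: measurable_EvM.
- by move=> mu [/supported_byP smu _]; rewrite /EvM /Ev smu.
Qed.

(** The inner integral is controlled on the ball supporting [MM] only: there
    [|int f dmu| <= gamma * sup |f|], and this makes the right-hand side
    continuous in [g] for the supremum norm. *)
Lemma sintegral_kappa_bounded (g : X -> R) : bounded_measurable g ->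
  sintegral (msmeasure_val (kappa MM)) g =
  sintegral mm (fun mu : M R X => sintegral (msmeasure_val mu) g).
Proof.
have [B [gamma [bB g0 sM]]] := MM_bound MM.
have bnd (f : X -> R) (r : R) : 0 <= r -> measurable_fun [set: X] f ->
    (forall x, `|f x| <= r) ->
    forall mu : M R X, Mball B gamma mu ->
    `|sintegral (msmeasure_val mu) f| <= r * gamma.
  move=> r0 mf fr mu [_ le].
  rewrite (le_trans (normr_sintegral_le (@supported_by_T _ _ _ _) mf r0 _))//.
  exact: ler_wpM2l.
move: g; apply: bounded_measurable_ind => [E mE|a g h bg bh Eg Eh|g bg happ].
- rewrite sintegral_indic// /Ev kappaE//=; congr sintegral.
  by apply/funext => mu; rewrite sintegral_indic.
- have [r r0 gr] := bounded_measurable_ge0 bg.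
  have [s s0 hs] := bounded_measurable_ge0 bh.
  have [[mg _] [mh _]] := (bg, bh).
  rewrite sintegral_lin_bounded// Eg Eh.
  rewrite -(sintegral_lin a sM _ _ (bnd _ _ r0 mg gr) (bnd _ _ s0 mh hs)).
  + congr sintegral; apply/funext => mu.
    by rewrite sintegral_lin_bounded.
  + exact: measurable_sintegral_bounded.
  + exact: measurable_sintegral_bounded.
- apply: (@eq_of_norm_le _ _ _ (tv_norm (msmeasure_val (kappa MM)) +
    gamma * tv_norm mm)) => e e0.
  have [s [bs Es gs]] := happ e e0.
  have [r r0 gr] := bounded_measurable_ge0 bg.
  have [r' r'0 sr] := bounded_measurable_ge0 bs.
  have [[mg _] [ms _]] := (bg, bs).
  rewrite -[X in `|X|](subrKA (sintegral (msmeasure_val (kappa MM)) s)) mulrDr.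
  rewrite (le_trans (ler_normD _ _))// lerD//.
    by apply: sintegral_approx_bounded => //; exact: ltW.
  rewrite Es distrC mulrA.
  apply: (sintegral_approx sM _ _ (bnd _ _ r0 mg gr) (bnd _ _ r'0 ms sr)).
  + exact: measurable_sintegral_bounded.
  + exact: measurable_sintegral_bounded.
  + by rewrite mulr_ge0// ltW.
  + move=> mu [_ le].
    rewrite (le_trans (sintegral_approx_bounded _ bg bs (ltW e0) gs))//.
    by rewrite ler_wpM2l// ltW.
Qed.

Lemma sintegral_kappa (g : X -> real_bornMeas R) : is_bornMeas_mor g ->
  sintegral (msmeasure_val (kappa MM)) (g : X -> R) =
  sintegral mm (fun mu : M R X => sintegral (msmeasure_val mu) (g : X -> R)).
Proof.
move=> hg; have [mg _] := hg.
have [B [gamma [bB g0 sM]]] := MM_bound MM.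
have [r r0 gr] := bounded_on_real hg bB.
have bc := bounded_measurable_clamp r0 (mg : measurable_fun setT (g : X -> R)).
have gc x : B x -> g x = (clamp r \o (g : X -> R)) x.
  by move=> Bx; rewrite /= clamp_id// gr.
rewrite (sintegral_eq_on (kappa_supported sM) mg (proj1 bc) gc).
rewrite sintegral_kappa_bounded//; apply: (sintegral_eq_on sM).
- exact: measurable_sintegral_bounded.
- exact: measurable_sintegral.
- move=> mu [sB _]; apply/esym; exact: (sintegral_eq_on sB mg (proj1 bc) gc).
Qed.

End fubini.
(** * The algebra of real numbers *)

Section algebra_iso.
Context (R : realType) (X Y : bornMeas) (c : M R X -> X) (d : M R Y -> Y).

Lemma mhom_inverse (phi : X -> Y) (psi : Y -> X) : is_bornMeas_mor phi ->
  psi \o phi = id -> phi \o psi = id -> is_mhom d c psi -> is_mhom c d phi.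
Proof.
move=> hphi psiK phiK [hpsi psid]; exists hphi.
apply/funext => mu /=.
have <- : Mmap hpsi (Mmap hphi mu) = mu.
  apply: msmeasure_ext => E mE.
  rewrite MmapE// MmapE; last exact: (mpre (proj1 hpsi)).
  by rewrite -comp_preimage psiK.
have := congr1 (fun f => f (Mmap hphi mu)) psid => /= <-.
have := congr1 (fun f => f (d (Mmap hphi mu))) phiK => /= ->.
congr d; apply: msmeasure_ext => E mE.
rewrite [in RHS]MmapE// [in RHS]MmapE; last exact: (mpre (proj1 hphi)).
by rewrite -comp_preimage phiK.
Qed.

End algebra_iso.

Section real_algebra.
Context (R : realType).

Lemma bornMeas_id (X : bornMeas) : is_bornMeas_mor (id : X -> X).
Proof. by split=> [|B]; [exact: measurable_id|rewrite image_id]. Qed.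

Lemma bornMeas_c_real : is_bornMeas_mor (@c_real R).
Proof. exact: (bornMeas_sintegral (bornMeas_id (real_bornMeas R))). Qed.

Lemma c_real_delta (x : real_bornMeas R) : c_real (delta R x) = x.
Proof.
rewrite /c_real (@sintegral_eq_on _ _ _ _ [set x] _ (cst (x : R))).
- rewrite sintegral_cst /Ev deltaE// diracE in_setT /=; exact: mulr1.
- apply/supported_byP => E mE Ex; rewrite deltaE// diracE memNset// => xE.
  by have : (E `&` [set x]) x by []; rewrite Ex.
- exact: measurable_id.
- exact: measurable_cst.
- by move=> _ ->.
Qed.

Lemma c_real_Mmap (X : bornMeas) (g : X -> real_bornMeas R)
    (hg : is_bornMeas_mor g) (mu : M R X) :
  c_real (Mmap hg mu) = sintegral (msmeasure_val mu) (g : X -> R).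
Proof.
have [B bB sB] := msmeasure_supported mu.
have [r r0 gr] := bounded_on_real hg bB.
have mid : measurable_fun [set: real_bornMeas R] (id : real_bornMeas R -> R).
  exact: measurable_id.
exact (sintegral_smap (proj1 hg) sB r0 mid gr).
Qed.

Lemma malgebra_real : is_malgebra (@c_real R).
Proof.
exists bornMeas_c_real; split; apply/funext => mu /=; first exact: c_real_delta.
rewrite c_real_Mmap; apply/esym.
exact: (sintegral_kappa mu (bornMeas_id (real_bornMeas R))).
Qed.

End real_algebra.

(** * The free algebra on a point *)

Section dirac_multiple.
Context (R : realType) (X : bornMeas) (x : X).

Lemma dirac_multiple_out (t : R) E : ~ measurable E ->
  cscale t (sdirac R x) E = 0%E.
Proof. by move=> mE; rewrite /cscale/= measurable_part_out// mule0. Qed.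

Definition dirac_multiple_smeasure (t : R) : smeasure X R :=
  SMeasure (dirac_multiple_out t).

Lemma dirac_multiple_smeasureE t E : measurable E ->
  dirac_multiple_smeasure t E = (t * \1_E x)%:E.
Proof. by move=> mE; rewrite /= /cscale/= -/(sdirac R x E) sdiracE. Qed.

Lemma dirac_multiple_supported (t : R) :
  supported_by (dirac_multiple_smeasure t) [set x].
Proof.
apply/supported_byP => E mE Ex; rewrite dirac_multiple_smeasureE//.
rewrite indicE memNset ?mulr0// => xE.
by have : (E `&` [set x]) x by []; rewrite Ex.
Qed.

Definition dirac_multiple (t : real_bornMeas R) : M R X :=
  exist _ (dirac_multiple_smeasure t)
    (ex_intro2 _ _ [set x] (bounded_set1 (bm_born X) x)
      (dirac_multiple_supported t)).

Lemma EvM_dirac_multiple t E : measurable E ->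
  EvM E (dirac_multiple t) = t * \1_E x.
Proof. by move=> mE; rewrite /EvM /Ev dirac_multiple_smeasureE. Qed.

Lemma bornMeas_dirac_multiple : is_bornMeas_mor dirac_multiple.
Proof.
split.
  apply: (@measurability _ _ (real_bornMeas R) (M R X) setT dirac_multiple
    (Ev_preimages (R := R) (X := X)) erefl).
  move=> _ [_ [E mE [U mU <-]] <-].
  rewrite !setTI -comp_preimage.
  rewrite (_ : _ \o _ = (fun t : R => t * \1_E x)); last first.
    by apply/funext => t; rewrite -EvM_dirac_multiple.
  by rewrite -[X in measurable X]setTI; apply: measurable_funM.
move=> A /RboundedP[r Ar].
exists [set x], (2 * `|r|); split; [exact: bounded_set1|by rewrite mulr_ge0|].
move=> _ [t At <-]; split; first exact: dirac_multiple_supported.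
apply: tv_norm_le => E mE; rewrite -/(EvM E (dirac_multiple t)).
rewrite EvM_dirac_multiple// normrM (le_trans (ler_piMr _ _))//.
  by rewrite indicE; case: (_ \in _); rewrite ?normr1 ?normr0.
by rewrite (le_trans (Ar t At))// ler_norm.
Qed.

End dirac_multiple.

Section free_on_point.
Context (R : realType).
Let one := one_bornMeas.

Definition mass (mu : M R one) : real_bornMeas R := EvM setT mu.

Lemma bornMeas_mass : is_bornMeas_mor mass.
Proof.
split; first exact: measurable_EvM.
move=> A [B [gamma [_ _ AB]]]; apply/RboundedP; exists gamma.
by move=> _ [mu /AB[_ le] <-]; exact: le_trans (EvM_tv _ _) le.
Qed.

Lemma massK : dirac_multiple (tt : one) \o mass = id.
Proof.
apply/funext => mu; apply: msmeasure_ext => E mE.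
rewrite dirac_multiple_smeasureE//= indicE /mass /EvM.
have [tE|tE] := boolP (tt \in E).
  have -> : E = setT by apply/seteqP; split=> // -[] _; exact: set_mem tE.
  by rewrite mulr1 EvE.
have -> : E = set0 by apply/seteqP; split=> // -[] /mem_set; rewrite (negbTE tE).
by rewrite mulr0 charge0.
Qed.

Lemma dirac_multipleK : mass \o dirac_multiple (tt : one) = id.
Proof.
by apply/funext => t; rewrite /= /mass EvM_dirac_multiple// indicE in_setT mulr1.
Qed.

Lemma mass_mhom : is_mhom (@kappa R one) (@c_real R) mass.
Proof.
exists bornMeas_mass; apply/funext => MM /=.
by rewrite c_real_Mmap /mass /EvM /Ev kappaE.
Qed.

End free_on_point.

Theorem proposition12p1 (R : realType) :
  is_malgebra (@c_real R) /\
  malg_isomorphic (@c_real R) (@kappa R one_bornMeas).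
Proof.
split; first exact: malgebra_real.
exists (dirac_multiple (tt : one_bornMeas)), (@mass R); split.
- apply: (mhom_inverse _ (dirac_multipleK R) (massK R) (mass_mhom R)).
  exact: bornMeas_dirac_multiple.
- exact: mass_mhom.
- exact: dirac_multipleK.
- exact: massK.
Qed.
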